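(* For $n\ge1$ let $$\mathbf Z_n=\sum_{j=0}^n(-4)^{n-j}\mathbf V_j .$$ If $\gamma(s,t)$ is a smooth family of unit-speed Legendrian curves in $S^3$ (with arclength parameter $s$ for each $t$) satisfying $\frac{\partial\gamma}{\partial t}=\mathbf Z_n[\gamma]$, then the curvature $k(s,t)$ satisfies $$k_t=M_{n+1},$$ i.e. $\mathbf Z_n$ induces the $(n+1)$st equation of the mKdV hierarchy for the curvature.
   Context: $S^3\subset\mathbb C^2$ is the set of unit vectors for the standard Hermitian inner product $\langle\cdot,\cdot\rangle$ (linear in the first slot). A regular curve $\gamma$ in $S^3$ is Legendrian if $\langle\gamma_s,\gamma\rangle=0$, and unit-speed if $\langle\gamma_s,\gamma_s\rangle=1$; its curvature is $k=\mathrm{Im}\langle\gamma_{ss},\gamma_s\rangle$. mKdV hierarchy: on differential polynomials in $u=u_0,u_1,u_2,\dots$ let $\delta P=\sum_{j\ge 0} u_{j+1}\,\partial P/\partial u_j$ (total $s$-derivative). Define differential polynomials recursively by $M_1=u_1$, $N_1=\frac12u^2$, $L_1=2u$, and for $j\ge1$: $M_{j+1}=\delta^2M_j+\delta(uN_j)$, $L_{j+1}=2(\delta M_j+uN_j)$ (so $\delta L_j=2M_j$), with $N_{j}$ the differential polynomial without constant term satisfying $\delta N_j=uM_j$ (such $N_j$ exists for every $j$). The $j$th mKdV equation is $u_t=M_j$; e.g. $M_2=u_3+\frac32u^2u_1$ gives the mKdV equation. The vector fields $\mathbf V_j$ are $$\mathbf V_0=\gamma_s,\qquad \mathbf V_j=N_j\gamma_s+M_j(\mathrm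 i\gamma_s)+L_j(\mathrm i\gamma)\quad(j\ge1),$$ where $u_i$ is replaced by the $i$-th $s$-derivative of the curvature $k$ of $\gamma$. *)

(* Defs.v *)
From HB Require Import structures.
From mathcomp Require Import all_boot all_order all_algebra.
From mathcomp Require Import finmap.
From mathcomp Require Import all_classical all_reals all_analysis.
From mathcomp Require Import complex.
From mathcomp Require Import -(notations) monalg.

Set Implicit Arguments.
Unset Strict Implicit.
Unset Printing Implicit Defensive.

Import Order.TTheory GRing.Theory Num.Theory.
Import numFieldNormedType.Exports.

Local Open Scope classical_set_scope.
Local Open Scope ring_scope.
Local Open Scope complex_scope.

Section DifferentialPolynomials.
Variable R : numFieldType.

(* Polynomials in the countably many variables u_0, u_1, u_2, ... *)
Definition diffpoly := malg (cmonom nat) R.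
Implicit Types (P Q : diffpoly) (i j : nat).

Definition dvar j : diffpoly := mkmalgU (ucm j) 1.

Definition partial_diff j P : diffpoly :=
  \sum_(m <- msupp P) (mcoeff m P *+ m j) *: mkmalgU (divcm m (ucm j)) 1.

(* A strict upper bound on the indices of the variables occurring in P. *)
Definition diff_order P : nat :=
  (\max_(m <- msupp P) \max_(i <- finsupp m) i.+1)%N.

Definition total_diff P : diffpoly :=
  \sum_(j < diff_order P) dvar j.+1 * partial_diff j P.

(* The differential polynomial P without constant term such that
   total_diff P = Q (and 0 if there is none). *)
Definition total_primitive Q : diffpoly :=
  xget 0 [set P : diffpoly | mcoeff (onecm nat) P = 0 /\ total_diff P = Q].

(* mkdv_triple i is (M_{i+1}, N_{i+1}, L_{i+1}). *)
Fixpoint mkdv_triple i : diffpoly * diffpoly * diffpoly :=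
  if i is i'.+1 then
    let: (M, N, L) := mkdv_triple i' in
    let M' := total_diff (total_diff M) + total_diff (dvar 0 * N) in
    (M', total_primitive (dvar 0 * M'), 2 *: (total_diff M + dvar 0 * N))
  else (dvar 1, 2^-1 *: dvar 0 ^+ 2, 2 *: dvar 0).

(* M_j, N_j, L_j; meaningful for j >= 1 only. *)
Definition mkdvM j : diffpoly := (mkdv_triple j.-1).1.1.
Definition mkdvN j : diffpoly := (mkdv_triple j.-1).1.2.
Definition mkdvL j : diffpoly := (mkdv_triple j.-1).2.

End DifferentialPolynomials.

(* The value at s of P when each u_i is replaced by the i-th derivative of f. *)
Definition diff_eval (R : realType) (P : diffpoly R) (f : R -> R) (s : R) : R :=
  \sum_(m <- msupp P) mcoeff m P * \prod_(i <- finsupp m) (f^`(i)%classic s) ^+ m i.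

Section Curves.
Variable R : realType.
Local Notation C2 := 'rV[R[i]]_2.

Definition hdot (x y : C2) : R[i] := \sum_j x 0 j * (y 0 j)^*%C.

(* The derivative of a curve in C^2, taken on real and imaginary parts of the
   coordinates. *)
Definition curve_deriv (c : R -> C2) (s : R) : C2 :=
  \row_j ((fun x => complex.Re (c x 0 j))^`()%classic s +i*
          (fun x => complex.Im (c x 0 j))^`()%classic s).

Definition unit_speed_legendrian (I : set R) (c : R -> C2) : Prop :=
  forall s, I s ->
    [/\ hdot (c s) (c s) = 1,
        hdot (curve_deriv c s) (c s) = 0
      & hdot (curve_deriv c s) (curve_deriv c s) = 1].

Definition curvature (c : R -> C2) (s : R) : R :=
  complex.Im (hdot (curve_deriv (curve_deriv c) s) (curve_deriv c s)).

(* f, as a function of two real variables, is of class C^k on D (meant for D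
   open): all iterated partial derivatives up to order k exist and are
   continuous on D. *)
Fixpoint Ck2_on (D : set (R * R)) (k : nat) (f : R -> R -> R) : Prop :=
  (forall p, D p -> {for p, continuous (fun q : R * R => f q.1 q.2)}) /\
  if k is k'.+1 then
    [/\ forall p, D p -> derivable (f ^~ p.2) p.1 1,
        forall p, D p -> derivable (f p.1) p.2 1,
        Ck2_on D k' (fun s t => (f ^~ t)^`()%classic s)
      & Ck2_on D k' (fun s t => (f s)^`()%classic t)]
  else True.

Definition smooth_family (I J : set R) (g : R -> R -> C2) : Prop :=
  forall k j,
    Ck2_on (I `*` J) k (fun s t => complex.Re (g s t 0 j)) /\
    Ck2_on (I `*` J) k (fun s t => complex.Im (g s t 0 j)).

Definition mkdv_field (j : nat) (c : R -> C2) (s : R) : C2 :=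
  if j is 0%N then curve_deriv c s else
    (diff_eval (mkdvN R j) (curvature c) s)%:C *: curve_deriv c s
  + (diff_eval (mkdvM R j) (curvature c) s)%:C *: ('i%C *: curve_deriv c s)
  + (diff_eval (mkdvL R j) (curvature c) s)%:C *: ('i%C *: c s).

Definition Zfield (n : nat) (c : R -> C2) (s : R) : C2 :=
  \sum_(j < n.+1) (- 4) ^+ (n - j) *: mkdv_field j c s.

End Curves.

(* Main.v *)
From HB Require Import structures.
Require Import Defs.
From mathcomp Require Import all_boot all_order all_algebra.
From mathcomp Require Import finmap.
From mathcomp Require Import all_classical all_reals all_analysis.
From mathcomp Require Import complex.
From mathcomp Require Import -(notations) monalg.
From mathcomp Require Import ring lra.

Set Implicit Arguments.
Unset Strict Implicit.
Unset Printing Implicit Defensive.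

Import Order.TTheory GRing.Theory Num.Theory.
Import numFieldNormedType.Exports.

Local Open Scope classical_set_scope.
Local Open Scope ring_scope.
Local Open Scope complex_scope.

(** Write [T = gamma_s] for the unit tangent and [k] for the curvature. The Legendrian
and unit-speed conditions say that [T, gamma] is a unitary frame, in which
[T_s = i k T - gamma] (legendrian_frenet). By linearity the flow has the form
[gamma_t = (N + i M) T + i L gamma], with [N], [M], [L] the combinations of the
[N_j], [M_j], [L_j] with weights [(-4)^(n-j)] (Zfield_frame).

Interchanging the derivatives in [s] and [t] (schwarz) twice expresses [T_t] and
[T_st] in the frame: [T_t = P T + Q gamma] with [P = (N_s - k M) + i (M_s + k N + L)]
and [Q = - N + i (L_s - M)]. Since the curves stay unit-speed and Legendrian,
differentiating [<T, T> = 1] and [<T, gamma> = 0] in [t] gives [N_s = k M] and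
[L_s = 2 M]. The derivative of [k = Im <T_s, T>] in [t] then comes out as
[(Im P)_s + 2 Im Q = M_ss + (k N)_s + 4 M] (curvature_flow). As the recursion reads
[M_{j+1} = (M_j)_ss + (k N_j)_s], each field [V_j] contributes [M_{j+1} + 4 M_j], and
the weighted sum telescopes to [M_{n+1}] (mkdv_telescope).

To pass between differential polynomials and functions of [s], evaluation at the
derivatives of [k] is shown to be a ring morphism that turns the total derivative
into d/ds (is_derive_diff_eval). The relations [N_s = k M] and [L_s = 2 M] are thus
obtained for the functions of [s] on the evolving curves, from the geometry of the
flow. *)

(** * The total derivative of differential polynomials *)

Section TotalDiff.
Variable R : numFieldType.
Implicit Types (P Q : diffpoly R) (m : cmonom nat).

(** The total derivative of a single monomial. Its sum runs over the variables
of the monomial itself, whereas [total_diff] uses one bound for all monomials of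
the polynomial; the per-monomial form is what makes linearity visible. *)
Definition total_diff_mon m : diffpoly R :=
  \sum_(j <- finsupp m) (m j)%:R *: (dvar R j.+1 * mkmalgU (divcm m (ucm j)) 1).

(** Exchanging the sums over monomials and over variables: a variable absent
from a monomial contributes nothing, and [diff_order] bounds all those present. *)
Lemma total_diffE P :
  total_diff P = \sum_(m <- msupp P) mcoeff m P *: total_diff_mon m.
Proof.
rewrite /total_diff /partial_diff.
under eq_bigr do rewrite mulr_sumr.
rewrite exchange_big /= !big_seq; apply: eq_bigr => m mP.
rewrite /total_diff_mon scaler_sumr.
have mj (j : nat) : j \in finsupp m -> (j < diff_order P)%N.
  move=> jm; rewrite /diff_order.
  have le1 : (j.+1 <= \max_(i <- finsupp m) i.+1)%N.
    by rewrite (big_rem j)//= leq_maxl.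
  by apply: leq_trans le1 _; rewrite (big_rem m)//= leq_maxl.
transitivity (\sum_(j < diff_order P | val j \in finsupp m)
   (mcoeff m P *+ m j) *: (dvar R j.+1 * mkmalgU (divcm m (ucm (val j))) 1)).
  rewrite [RHS]big_mkcond/=; apply: eq_bigr => j _.
  case: ifPn => jm; first by rewrite scalerAr.
  by rewrite -cmE_eq0 in jm; rewrite (eqP jm) mulr0n scale0r mulr0.
rewrite -(big_mkord (fun j => j \in finsupp m)
  (fun j => (mcoeff m P *+ m j) *: (dvar R j.+1 * mkmalgU (divcm m (ucm j)) 1))).
rewrite -big_filter.
under [RHS]eq_bigr do rewrite scalerA mulr_natr.
apply: perm_big; apply: uniq_perm.
- exact/filter_uniq/iota_uniq.
- exact: fset_uniq.
- move=> j; rewrite mem_filter mem_index_iota /=.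
  by case: (boolP (j \in finsupp m)) => // /mj ->.
Qed.

(** All three supports are enlarged to the union of those of [P] and [Q],
where the missing coefficients vanish. *)
Lemma total_diff_is_linear : linear (@total_diff R).
Proof.
move=> c P Q; rewrite !total_diffE.
pose d := (msupp P `|` msupp Q)%fset.
have H (A : diffpoly R) : (msupp A `<=` d)%fset ->
  \sum_(m <- msupp A) mcoeff m A *: total_diff_mon m =
  \sum_(m <- d) mcoeff m A *: total_diff_mon m.
  move=> Ad; apply: big_fset_incl => // m _ /mcoeff_outdom ->.
  by rewrite scale0r.
rewrite (H P) ?fsubsetUl// (H Q) ?fsubsetUr// H; last first.
  apply: fsubset_trans (msuppD_le _ _) _; apply: fsetSU.
  exact: msuppZ_le.
rewrite scaler_sumr -big_split /=; apply: eq_bigr => m _.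
by rewrite mcoeffD mcoeffZ scalerDl scalerA.
Qed.

Lemma total_diffD P Q : total_diff (P + Q) = total_diff P + total_diff Q.
Proof. by rewrite -[P in LHS]scale1r total_diff_is_linear scale1r. Qed.

Lemma total_diff0 : total_diff (0 : diffpoly R) = 0.
Proof. by apply: (@addrI _ (total_diff 0)); rewrite -total_diffD !addr0. Qed.

Lemma total_diffZ c P : total_diff (c *: P) = c *: total_diff P.
Proof. by rewrite -[c *: P]addr0 total_diff_is_linear total_diff0 addr0. Qed.

Lemma total_diff_dvar j : total_diff (dvar R j) = dvar R j.+1.
Proof.
rewrite total_diffE /dvar msuppU1 big_seq_fset1 mcoeffUU scale1r.
rewrite /total_diff_mon mdomU big_seq_fset1 cmUU scale1r.
suff -> : divcm (ucm j) (ucm j) = onecm nat by rewrite [X in _ * X]mpolyC1E mulr1.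
by apply/eqP/cmP => i; rewrite divcmE subnn onecmE.
Qed.

End TotalDiff.

(** * Evaluation of differential polynomials along a function *)

Section Evaluation.
Variable R : realType.
Implicit Types (P Q : diffpoly R) (f : R -> R) (s : R) (m : cmonom nat).

Definition mon_eval f s m : R :=
  \prod_(i <- finsupp m) (f^`(i)%classic s) ^+ m i.

Lemma mon_evalEw f s m (d : {fset nat}) : (finsupp m `<=` d)%fset ->
  mon_eval f s m = \prod_(i <- d) (f^`(i)%classic s) ^+ m i.
Proof.
move=> md; apply: big_fset_incl => // i _.
by rewrite -cmE_eq0 => /eqP ->; rewrite expr0.
Qed.

(** [diff_eval] is convertible to the evaluation map [mmap] of monoid algebras,
which is a ring morphism as soon as monomials are evaluated multiplicatively. *)
Lemma mon_eval_mmorphism f s : mmorphism (mon_eval f s).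
Proof.
split=> [m1 m2|]; last by rewrite /mon_eval mdom1 big_seq_fset0.
pose d := (finsupp m1 `|` finsupp m2)%fset.
rewrite !(mon_evalEw f s (d := d)) ?fsubsetUl ?fsubsetUr ?mdomD//.
by rewrite -big_split /=; apply: eq_bigr => i _; rewrite cmM exprD.
Qed.

HB.instance Definition _ f s := isMultiplicative.Build (cmonom nat) R
  (mon_eval f s) (mon_eval_mmorphism f s).

Lemma diff_evalD f s P Q :
  diff_eval (P + Q) f s = diff_eval P f s + diff_eval Q f s.
Proof. exact: (raddfD (mmap idfun (mon_eval f s))). Qed.

Lemma diff_eval0 f s : diff_eval 0 f s = 0.
Proof. exact: (raddf0 (mmap idfun (mon_eval f s))). Qed.

Lemma diff_evalN f s P : diff_eval (- P) f s = - diff_eval P f s.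
Proof. exact: (raddfN (mmap idfun (mon_eval f s))). Qed.

Lemma diff_evalB f s P Q :
  diff_eval (P - Q) f s = diff_eval P f s - diff_eval Q f s.
Proof. exact: (raddfB (mmap idfun (mon_eval f s))). Qed.

Lemma diff_evalZ f s c P : diff_eval (c *: P) f s = c * diff_eval P f s.
Proof. exact: (@mmapZ _ _ _ idfun (mon_eval f s)). Qed.

Lemma diff_evalM f s P Q :
  diff_eval (P * Q) f s = diff_eval P f s * diff_eval Q f s.
Proof. exact: (rmorphM (mmap idfun (mon_eval f s))). Qed.

Lemma diff_eval_sum f s (T : Type) (r : seq T) (F : T -> diffpoly R) :
  diff_eval (\sum_(i <- r) F i) f s = \sum_(i <- r) diff_eval (F i) f s.
Proof. exact: (raddf_sum (mmap idfun (mon_eval f s))). Qed.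

Lemma diff_eval1 f s : diff_eval 1 f s = 1.
Proof. exact: (rmorph1 (mmap idfun (mon_eval f s))). Qed.

Lemma diff_eval_mon f s m : diff_eval (mkmalgU m 1) f s = mon_eval f s m.
Proof. by rewrite [LHS](mmapU (f := idfun)) mul1r. Qed.

Lemma diff_eval_dvar f s j : diff_eval (dvar R j) f s = f^`(j)%classic s.
Proof. by rewrite diff_eval_mon /mon_eval mdomU big_seq_fset1 cmUU. Qed.

Lemma diff_eval_u0M f s P : diff_eval (dvar R 0 * P) f s = f s * diff_eval P f s.
Proof. by rewrite diff_evalM; congr (_ * _); rewrite diff_eval_dvar. Qed.

Lemma is_derive_congr (f g : R -> R) s (d e : R) :
  is_derive s 1 f d -> f =1 g -> d = e -> is_derive s 1 g e.
Proof. by move=> + /funext <- <-. Qed.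

(** The exponent is decreased by the truncated difference with [j == i]: this
is the shape of the exponents of the quotient monomial in [partial_diff], and the
truncation at exponent 0 is harmless because of the factor [e j]. *)
Lemma is_derive_prodX (F F' : nat -> R -> R) (e : nat -> nat) (r : seq nat) s :
  uniq r -> (forall i, is_derive s 1 (F i) (F' i s)) ->
  is_derive s 1 (fun x => \prod_(i <- r) F i x ^+ e i)
    (\sum_(j <- r) (e j)%:R * (F' j s * \prod_(i <- r) F i s ^+ (e i - (j == i)))).
Proof.
move=> + dF; elim: r => [|a r IH] /=.
  move=> _; rewrite big_nil.
  by under eq_fun do rewrite big_nil; exact: is_derive_cst.
case/andP=> ar /IH{}IH; under eq_fun do rewrite big_cons.
have dXa : is_derive s 1 (fun x => F a x ^+ e a)
    ((e a)%:R * (F' a s * F a s ^+ (e a - 1))).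
  apply: (is_derive_congr (is_deriveX (e a) (dF a))).
    by move=> x; rewrite exprfctE.
  by rewrite subn1 /GRing.scale /= -mulr_natl; ring.
apply: (is_derive_congr (is_deriveM dXa IH)) => //.
rewrite big_cons addrC; congr (_ + _).
  rewrite big_cons eqxx.
  rewrite [X in _ = _ * (_ * (_ * X))](eq_big_seq (fun i => F i s ^+ e i)); last first.
    by move=> i ir; rewrite (_ : (a == i) = false) ?subn0//; apply: contraNF ar => /eqP ->.
  by rewrite /GRing.scale /=; ring.
rewrite /GRing.scale /= mulr_sumr; apply: eq_big_seq => j jr.
rewrite big_cons (_ : (j == a) = false) ?subn0; last by apply: contraNF ar => /eqP <-.
by ring.
Qed.

Lemma is_derive_sum_seq (T : Type) (r : seq T) (F : T -> R -> R) (F' : T -> R) s :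
  (forall i, is_derive s 1 (F i) (F' i)) ->
  is_derive s 1 (fun x => \sum_(i <- r) F i x) (\sum_(i <- r) F' i).
Proof.
move=> dF; elim: r => [|a r IH].
  by rewrite big_nil; under eq_fun do rewrite big_nil; exact: is_derive_cst.
by rewrite big_cons; under eq_fun do rewrite big_cons; exact: is_deriveD.
Qed.

(** The total derivative is the chain rule: it suffices to treat a monomial,
where the formula is the Leibniz rule for a product of powers. *)
Lemma is_derive_diff_eval f s P :
  (forall j, derivable (f^`(j)%classic) s 1) ->
  is_derive s 1 (diff_eval P f) (diff_eval (total_diff P) f s).
Proof.
move=> df.
have dmon m : is_derive s 1 (mon_eval f ^~ m) (diff_eval (total_diff_mon R m) f s).
  have := @is_derive_prodX (fun j => f^`(j)%classic) (fun j => f^`(j.+1)%classic) m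
     (finsupp m) s (fset_uniq _) _.
  have H j : is_derive s 1 f^`(j)%classic (f^`(j.+1)%classic s).
    by rewrite derive1nS derive1E; exact/derivableP.
  move=> /(_ H) /is_derive_congr; apply=> //.
  rewrite /total_diff_mon diff_eval_sum.
  apply: eq_bigr => j _.
  rewrite diff_evalZ.
  rewrite diff_evalM; congr (_ * (_ * _)); first by rewrite diff_eval_dvar.
  rewrite diff_eval_mon.
  rewrite (mon_evalEw f s (d := finsupp m)); last first.
    apply/fsubsetP => i; rewrite -!cmE_neq0 divcmE; apply: contraNneq => ->.
    by rewrite sub0n.
  by apply: eq_bigr => i _; rewrite divcmE cmU.
rewrite total_diffE diff_eval_sum.
apply: is_derive_sum_seq => m; rewrite diff_evalZ.
exact: is_deriveZ.
Qed.

End Evaluation.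

(** * Telescoping in the mKdV hierarchy *)

Section WeightedSums.
Variables (K : pzRingType) (V : lmodType K).

Definition wsum (F : nat -> V) n : V := \sum_(j < n.+1) (- 4%:R) ^+ (n - j) *: F j.

Lemma wsum0 F : wsum F 0 = F 0%N.
Proof. by rewrite /wsum big_ord1 subnn expr0 scale1r. Qed.

(** Horner's rule, which allows induction on the number of terms. *)
Lemma wsumS F n : wsum F n.+1 = (- 4%:R) *: wsum F n + F n.+1.
Proof.
rewrite /wsum big_ord_recr /= subnn expr0 scale1r scaler_sumr; congr (_ + _).
by apply: eq_bigr => j _; rewrite scalerA -exprS subSn// -ltnS.
Qed.

End WeightedSums.

Section Hierarchy.
Variable R : numFieldType.

Lemma mkdvMS j : mkdvM R j.+2 =
  total_diff (total_diff (mkdvM R j.+1)) + total_diff (dvar R 0 * mkdvN R j.+1).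
Proof. by rewrite /mkdvM /mkdvN /=; case: mkdv_triple => -[]. Qed.

(** The coefficients of the [j]th vector field along the tangent, its rotation by
i, and the rotated position; for [j = 0] the field is the tangent itself. *)
Definition fieldN j : diffpoly R := if j is j'.+1 then mkdvN R j else 1.
Definition fieldM j : diffpoly R := if j is j'.+1 then mkdvM R j else 0.
Definition fieldL j : diffpoly R := if j is j'.+1 then mkdvL R j else 0.

(** The normal component [M] of a flow contributes both its share of the
recursion and an extra term [4 M]; in the combination with weights [(-4)^(n-j)]
the extra terms cancel all members of the hierarchy but the last. *)
Lemma mkdv_telescope n :
  total_diff (total_diff (wsum fieldM n)) + total_diff (dvar R 0 * wsum fieldN n)
    + 4%:R *: wsum fieldM n = mkdvM R n.+1.
Proof.
elim: n => [|n IH].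
  by rewrite !wsum0 /= mulr1 total_diff_dvar !total_diff0 scaler0 add0r addr0.
rewrite !wsumS /= (mkdvMS n) mulrDr -scalerAr !(total_diffD, total_diffZ) [4%:R *: (_ +
  _)]scalerDr.
(* An abstract module keeps the unifier from unfolding polynomials. *)
have cancel4 (V : lmodType R) (a b w m c d : V) : a + b + 4%:R *: w = m ->
    - 4%:R *: a + c + (- 4%:R *: b + d) + (4%:R *: (- 4%:R *: w) + 4%:R *: m) = c + d.
  move=> <-; rewrite !scalerDr !scaleNr scalerN.
  rewrite [- _ + c]addrC [- _ + d]addrC [c - _ + _]addrACA -opprD [- (4 *: _) + _]addrC.
  by rewrite addrK subrK.
exact: cancel4.
Qed.
End Hierarchy.

(** * Smooth functions of one variable *)

Section SmoothOneVariable.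
Variable R : realType.
Implicit Types (f g : R -> R) (I : set R).

(** The derivatives are taken as total functions and only their behaviour on [I]
is constrained, as for [Ck2_on]. *)
Fixpoint Ck1_on I k f : Prop :=
  (forall s, I s -> derivable f s 1) /\
  if k is k'.+1 then Ck1_on I k' f^`()%classic else True.

Definition smooth1 I f := forall k, Ck1_on I k f.

Lemma Ck1_derivable I k f s : Ck1_on I k f -> I s -> derivable f s 1.
Proof. by case: k => [|k] [+ _]; apply. Qed.

Lemma Ck1_onW I k f : Ck1_on I k.+1 f -> Ck1_on I k f.
Proof.
elim: k f => [|k IH] f [df f'k]; first by split.
by split => //; apply: IH.
Qed.

Lemma smooth1_derivable I f n s : smooth1 I f -> I s ->
  derivable (f^`(n)%classic) s 1.
Proof.
move=> + Is; elim: n f => [|n IH] f fI; first exact: (Ck1_derivable (fI 0)).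
by rewrite derive1Sn; apply: IH => k; case: (fI k.+1).
Qed.

Lemma open_near I s (P : R -> Prop) : open I -> I s -> (forall x, I x -> P x) ->
  \forall x \near s, P x.
Proof. by move=> oI Is IP; apply: filterS IP _; exact: open_nbhs_nbhs. Qed.

Lemma Ck1_on_eq I k f g : open I -> (forall x, I x -> f x = g x) ->
  Ck1_on I k f -> Ck1_on I k g.
Proof.
move=> oI; elim: k f g => [|k IH] f g fg [df fk]; split.
- by move=> s Is; exact: near_eq_derivable (open_near oI Is fg) (df s Is).
- by [].
- by move=> s Is; exact: near_eq_derivable (open_near oI Is fg) (df s Is).
- apply: IH fk => x Ix; rewrite !derive1E; apply: near_eq_derive.
  exact: open_near oI Ix fg.
Qed.

Lemma Ck1_onD I k f g : open I ->
  Ck1_on I k f -> Ck1_on I k g -> Ck1_on I k (fun x => f x + g x).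
Proof.
move=> oI; elim: k f g => [|k IH] f g [df fk] [dg gk]; split.
- by move=> s Is; apply: derivableD; [exact: df|exact: dg].
- by [].
- by move=> s Is; apply: derivableD; [exact: df|exact: dg].
- apply: (Ck1_on_eq oI _ (IH _ _ fk gk)) => x Ix.
  by rewrite !derive1E deriveD; [|exact: df|exact: dg].
Qed.

Lemma Ck1_onN I k f : open I -> Ck1_on I k f -> Ck1_on I k (fun x => - f x).
Proof.
move=> oI; elim: k f => [|k IH] f [df fk]; split.
- by move=> s Is; apply: derivableN; exact: df.
- by [].
- by move=> s Is; apply: derivableN; exact: df.
- apply: (Ck1_on_eq oI _ (IH _ fk)) => x Ix.
  by rewrite !derive1E deriveN; [|exact: df].
Qed.

Lemma Ck1_onM I k f g : open I ->
  Ck1_on I k f -> Ck1_on I k g -> Ck1_on I k (fun x => f x * g x).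
Proof.
move=> oI; elim: k f g => [|k IH] f g fk gk; split.
- by move=> s Is; apply: derivableM; exact: (@Ck1_derivable I 0).
- by [].
- by move=> s Is; apply: derivableM; exact: (@Ck1_derivable I k.+1).
- have [df f'k] := fk; have [dg g'k] := gk.
  apply: (Ck1_on_eq oI _ (Ck1_onD oI (IH _ _ (Ck1_onW fk) g'k) (IH _ _ (Ck1_onW gk)
    f'k))) => x Ix.
  by rewrite !derive1E deriveM; [|exact: df|exact: dg].
Qed.

End SmoothOneVariable.

(** * Smooth functions of two variables and interchange of derivatives *)

Section SmoothTwoVariables.
Variable R : realType.
Implicit Types (f : R -> R -> R) (D : set (R * R)) (s t h : R).

Definition partial1 f s t := (f ^~ t)^`()%classic s.
Definition partial2 f s t := (f s)^`()%classic t.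

Definition smooth2 D f := forall k, Ck2_on D k f.

Lemma smooth2_partial1 D f : smooth2 D f -> smooth2 D (partial1 f).
Proof. by move=> fD k; case: (fD k.+1) => _ []. Qed.

Lemma smooth2_partial2 D f : smooth2 D f -> smooth2 D (partial2 f).
Proof. by move=> fD k; case: (fD k.+1) => _ []. Qed.

Lemma smooth2_derivable1 D f s t : smooth2 D f -> D (s, t) -> derivable (f ^~ t) s 1.
Proof. by move=> /(_ 1%N)[_ [/(_ (s, t))]]. Qed.

Lemma smooth2_derivable2 D f s t : smooth2 D f -> D (s, t) -> derivable (f s) t 1.
Proof. by move=> /(_ 1%N)[_ [_ /(_ (s, t))]]. Qed.

Lemma smooth2_continuous D f s t : smooth2 D f -> D (s, t) ->
  {for (s, t), continuous (fun q : R * R => f q.1 q.2)}.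
Proof. by move=> /(_ 0%N)[/(_ (s, t))]. Qed.

Lemma smooth2_slice I J f t : smooth2 (I `*` J) f -> J t -> smooth1 I (f ^~ t).
Proof.
move=> + Jt k; elim: k f => [|k IH] f fIJ; split.
- by move=> s Is; apply: smooth2_derivable1 fIJ _.
- by [].
- by move=> s Is; apply: smooth2_derivable1 fIJ _.
- exact: IH (smooth2_partial1 fIJ).
Qed.

Lemma mean_value (g : R -> R) a h : 0 < h ->
  (forall x, a <= x <= a + h -> derivable g x 1) ->
  exists2 c, a <= c <= a + h & g (a + h) - g a = g^`()%classic c * h.
Proof.
move=> h0 dg.
have ah : a < a + h by rewrite ltrDl.
have [||c] := @MVT R g g^`()%classic a (a + h) ah.
- move=> x; rewrite in_itv /= => /andP[ax xh].
  by rewrite derive1E; apply/derivableP/dg; rewrite !ltW.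
- apply: derivable_within_continuous => x; rewrite in_itv /=; exact: dg.
rewrite in_itv /= => /andP[ac ca] E; exists c; first by rewrite !ltW.
by rewrite E addrAC subrr add0r.
Qed.

(** Two applications of the mean value theorem, in the first variable to the
increment in the second one, then in the second variable. *)
Lemma second_difference f s t h : 0 < h ->
  (forall x y, s <= x <= s + h -> t <= y <= t + h ->
     derivable (f ^~ y) x 1 /\ derivable (partial1 f x) y 1) ->
  exists p : R * R, [/\ s <= p.1 <= s + h, t <= p.2 <= t + h &
    f (s + h) (t + h) - f (s + h) t - (f s (t + h) - f s t)
      = partial2 (partial1 f) p.1 p.2 * h * h].
Proof.
move=> h0 df.
have tt : t <= t <= t + h by rewrite lexx lerDl ltW.
have th : t <= t + h <= t + h by rewrite lexx lerDl ltW.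
have [c cs Ec] := @mean_value (fun x => f x (t + h) - f x t) s h h0 (fun x xs =>
  derivableB (df x _ xs th).1 (df x _ xs tt).1).
have [e et Ee] := @mean_value (partial1 f c) t h h0 (fun y yt => (df c y cs yt).2).
exists (c, e); split => //=; rewrite -[partial2 _ _ _ * h]Ee Ec; congr (_ * _).
rewrite derive1E deriveB; [|exact: (df c _ cs th).1|exact: (df c _ cs tt).1].
by rewrite /partial1 2!derive1E.
Qed.

Lemma nbhs_pair_ball (p : R * R) D : nbhs p D ->
  exists2 r : R, 0 < r & ball p r `<=` D.
Proof. by move/nbhs_ballP => -[r r0 rD]; exists r. Qed.

(** Both mixed derivatives, taken at suitable points of an arbitrarily small
square, equal the same second difference quotient; continuity concludes. *)
Lemma schwarz D f s t : open D -> smooth2 D f -> D (s, t) ->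
  partial2 (partial1 f) s t = partial1 (partial2 f) s t.
Proof.
move=> oD fD Dst; apply/eqP; rewrite -subr_eq0 -normr_eq0; apply: contraT => n0.
set e := `|_| in n0.
have e0 : 0 < e / 2 by rewrite divr_gt0 // lt_neqAle eq_sym n0 normr_ge0.
have c12 := smooth2_continuous (smooth2_partial2 (smooth2_partial1 fD)) Dst.
have c21 := smooth2_continuous (smooth2_partial1 (smooth2_partial2 fD)) Dst.
have nD : nbhs (s, t) D by exact: open_nbhs_nbhs.
have n12 := (@cvgrPdist_lt _ _ _ _ (nbhs_filter (s, t))
  (fun q : R * R => partial2 (partial1 f) q.1 q.2) (partial2 (partial1 f) s t)).1 c12 _ e0.
have n21 := (@cvgrPdist_lt _ _ _ _ (nbhs_filter (s, t))
  (fun q : R * R => partial1 (partial2 f) q.1 q.2) (partial1 (partial2 f) s t)).1 c21 _ e0.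
have [r r0 Hr] := nbhs_pair_ball (filterI nD (filterI n12 n21)).
pose h := r / 2.
have h0 : 0 < h by rewrite divr_gt0.
have near_r a x : a <= x <= a + h -> `|a - x| < r.
  move=> /andP[ax xh]; rewrite distrC ger0_norm ?subr_ge0// ltrBlDl.
  by apply: le_lt_trans xh _; rewrite ltrD2l /h ltr_pdivrMr// mulr_natr mulr2n ltrDl.
have Hst x y : s <= x <= s + h -> t <= y <= t + h -> ball (s, t) r (x, y).
  by move=> xs yt; split; exact: near_r.
have [x y xs yt|p [p1 p2 Ep]] := @second_difference f s t h h0 _.
  have [Dxy _] := Hr _ (Hst _ _ xs yt).
  by split; [exact: smooth2_derivable1 fD _|exact: smooth2_derivable2 (smooth2_partial1
    fD) _].
(* The second difference is symmetric in the two variables. *)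
have [x y xs yt|q [q1 q2 Eq]] := @second_difference (fun y x => f x y) t s h h0 _.
  have [Dxy _] := Hr _ (Hst _ _ yt xs).
  by split; [exact: smooth2_derivable2 fD _|exact: smooth2_derivable1 (smooth2_partial2
    fD) _].
have [_ [H1 _]] := Hr _ (Hst _ _ p1 p2).
have [_ [_ H2]] := Hr _ (Hst _ _ q2 q1).
rewrite /= in H1 H2.
have {}Eq : f (s + h) (t + h) - f s (t + h) - (f (s + h) t - f s t) =
    partial1 (partial2 f) q.2 q.1 * h * h := Eq.
have E12 : partial2 (partial1 f) p.1 p.2 = partial1 (partial2 f) q.2 q.1.
  move: (partial2 (partial1 f) _ _) (partial1 (partial2 f) _ _) Ep Eq {H1 H2} => a b Ep Eq.
  have hn : h != 0 by rewrite gt_eqF.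
  have ab : a * h * h = b * h * h by rewrite -Ep -Eq; ring.
  exact: (mulIf hn (mulIf hn ab)).
rewrite E12 in H1.
have : e < e / 2 + e / 2.
  apply: le_lt_trans (ltrD H1 H2).
  by rewrite [X in _ + X]distrC; exact: ler_distD.
by rewrite -splitr ltxx.
Qed.

End SmoothTwoVariables.

(** * The Hermitian plane *)

Section HermitianPlane.
Variable R : realType.
Local Notation C2 := 'rV[R[i]]_2.
Implicit Types (x y v : C2) (a : R[i]).

Lemma hdotDl x y v : hdot (x + y) v = hdot x v + hdot y v.
Proof. by rewrite -big_split; apply: eq_bigr => j _; rewrite mxE mulrDl. Qed.

Lemma hdotZl a x v : hdot (a *: x) v = a * hdot x v.
Proof. by rewrite /hdot mulr_sumr; apply: eq_bigr => j _; rewrite mxE mulrA. Qed.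

Lemma hdot_conj x y : hdot y x = (hdot x y)^*%C.
Proof.
rewrite /hdot rmorph_sum; apply: eq_bigr => j _.
by rewrite rmorphM /= conjcK mulrC.
Qed.

Lemma hdotDr x y v : hdot v (x + y) = hdot v x + hdot v y.
Proof. by rewrite hdot_conj hdotDl rmorphD /= -!hdot_conj. Qed.

Lemma hdotZr a x v : hdot v (a *: x) = a^*%C * hdot v x.
Proof. by rewrite hdot_conj hdotZl rmorphM /= -!hdot_conj. Qed.

(** A matrix with orthonormal rows has its adjoint as right inverse, hence also
as left inverse. *)
Lemma orthonormal_expansion x y v :
  hdot x x = 1 -> hdot y y = 1 -> hdot x y = 0 ->
  v = hdot v x *: x + hdot v y *: y.
Proof.
move=> xx yy xy.
have yx : hdot y x = 0 by rewrite hdot_conj xy conjc0.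
pose U : 'M[R[i]]_2 := \matrix_(i, j) (if i == 0 then x 0 j else y 0 j).
pose V : 'M[R[i]]_2 := \matrix_(i, j) (U j i)^*%C.
have UV : U *m V = 1%:M.
  apply/matrixP => i j; rewrite !mxE.
  under eq_bigr do rewrite !mxE.
  have i01 (l : 'I_2) : l = 0 \/ l = 1.
    by case: l => [[|[|//]] ?]; [left|right]; exact: val_inj.
  by case: (i01 i) => ->; case: (i01 j) => ->.
have VU := mulmx1C UV.
rewrite -[LHS]mulmx1 -VU mulmxA; apply/rowP => j; rewrite !mxE.
rewrite big_ord_recl big_ord1 !mxE /=; congr (_ * _ + _ * _);
  by apply: eq_bigr => l _; rewrite !mxE.
Qed.

End HermitianPlane.

(** * Derivatives of complex functions and of curves in the plane *)

Section ComplexDerivative.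
Variable R : realType.
Local Notation C2 := 'rV[R[i]]_2.
Implicit Types (F G : R -> R[i]) (c d : R -> C2) (s : R) (z w : R[i]) (u v : C2).

Definition is_cderive F s z :=
  is_derive s 1 (fun x => complex.Re (F x)) (complex.Re z) /\
  is_derive s 1 (fun x => complex.Im (F x)) (complex.Im z).

Lemma ReD z w : complex.Re (z + w) = complex.Re z + complex.Re w.
Proof. by case: z w => ? ? []. Qed.

Lemma ImD z w : complex.Im (z + w) = complex.Im z + complex.Im w.
Proof. by case: z w => ? ? []. Qed.

Lemma ReM z w :
  complex.Re (z * w) = complex.Re z * complex.Re w - complex.Im z * complex.Im w.
Proof. by case: z w => ? ? []. Qed.

Lemma ImM z w :
  complex.Im (z * w) = complex.Re z * complex.Im w + complex.Im z * complex.Re w.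
Proof. by case: z w => ? ? []. Qed.

Lemma ReJ z : complex.Re z^*%C = complex.Re z.
Proof. by case: z. Qed.

Lemma ImJ z : complex.Im z^*%C = - complex.Im z.
Proof. by case: z. Qed.

Lemma is_cderiveD F G s z w : is_cderive F s z -> is_cderive G s w ->
  is_cderive (fun x => F x + G x) s (z + w).
Proof.
move=> [F1 F2] [G1 G2]; split.
- by apply: (is_derive_congr (is_deriveD F1 G1)); [move=> x|]; rewrite ReD.
- by apply: (is_derive_congr (is_deriveD F2 G2)); [move=> x|]; rewrite ImD.
Qed.

Lemma is_cderiveM F G s z w : is_cderive F s z -> is_cderive G s w ->
  is_cderive (fun x => F x * G x) s (z * G s + F s * w).
Proof.
move=> [F1 F2] [G1 G2]; split.
- apply: (is_derive_congr (is_deriveB (is_deriveM F1 G1) (is_deriveM F2 G2))).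
    by move=> x; rewrite ReM.
  by rewrite ReD !ReM /GRing.scale /=; ring.
- apply: (is_derive_congr (is_deriveD (is_deriveM F1 G2) (is_deriveM F2 G1))).
    by move=> x; rewrite ImM.
  by rewrite ImD !ImM /GRing.scale /=; ring.
Qed.

Lemma is_cderive_conj F s z : is_cderive F s z -> is_cderive (fun x => (F x)^*%C) s z^*%C.
Proof.
move=> [F1 F2]; split.
- by apply: (is_derive_congr F1); [move=> x|]; rewrite ReJ.
- by apply: (is_derive_congr (is_deriveN F2)); [move=> x|]; rewrite ImJ.
Qed.

Lemma is_cderive_cst (w : R[i]) s : is_cderive (fun=> w) s 0.
Proof. by split; exact: is_derive_cst. Qed.

Lemma is_cderive_near F G s z : (\forall x \near s, F x = G x) ->
  is_cderive F s z -> is_cderive G s z.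
Proof.
move=> FG [F1 F2]; split.
- by apply: near_eq_is_derive F1; apply: filterS FG => x ->.
- by apply: near_eq_is_derive F2; apply: filterS FG => x ->.
Qed.

Lemma is_cderive_unique F s z w : is_cderive F s z -> is_cderive F s w -> z = w.
Proof.
move=> [[_ F1] [_ F2]] [[_ G1] [_ G2]]; apply/eqP; rewrite eq_complex.
by rewrite -F1 -G1 -F2 -G2 !eqxx.
Qed.

Definition is_vderive c s (v : C2) := forall j, is_cderive (fun x => c x 0 j) s (v 0 j).

Lemma is_vderive_eq c s v : is_vderive c s v -> curve_deriv c s = v.
Proof.
move=> cv; apply/rowP => j; rewrite mxE.
case: (cv j) => -[_ +] [_ +]; rewrite -!derive1E => -> ->.
by case: (v 0 j).
Qed.

Lemma is_vderiveD c d s u v : is_vderive c s u -> is_vderive d s v ->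
  is_vderive (fun x => c x + d x) s (u + v).
Proof.
move=> cv dw j; rewrite mxE; under eq_fun do rewrite mxE.
by apply: is_cderiveD; [exact: cv|exact: dw].
Qed.

Lemma is_vderiveZ F c s z v : is_cderive F s z -> is_vderive c s v ->
  is_vderive (fun x => F x *: c x) s (z *: c s + F s *: v).
Proof.
move=> Fz cv j; rewrite !mxE; under eq_fun do rewrite mxE.
by apply: is_cderiveM => //; exact: cv.
Qed.

Lemma is_vderive_near c d s v : (\forall x \near s, c x = d x) ->
  is_vderive c s v -> is_vderive d s v.
Proof.
by move=> cd cv j; apply: is_cderive_near (cv j); apply: filterS cd => x ->.
Qed.

Lemma is_cderive_hdot c d s u v : is_vderive c s u -> is_vderive d s v ->
  is_cderive (fun x => hdot (c x) (d x)) s (hdot u (d s) + hdot (c s) v).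
Proof.
move=> cv dw; rewrite /hdot -big_split big_ord_recl big_ord1.
under eq_fun do rewrite big_ord_recl big_ord1.
by apply: is_cderiveD; apply: is_cderiveM => //; apply: is_cderive_conj.
Qed.

(** The linearization of a normalization condition that holds on an open set of
parameters; it serves both for the arclength and for the time variable. *)
Lemma hdot_constant_derive (I : set R) c d s u v z : open I -> I s ->
  (forall x, I x -> hdot (c x) (d x) = z) ->
  is_vderive c s u -> is_vderive d s v -> hdot u (d s) + hdot (c s) v = 0.
Proof.
move=> oI Is cst cv dw; apply: (@is_cderive_unique (fun=> z) s); last exact: is_cderive_cst.
exact: is_cderive_near (open_near oI Is cst) (is_cderive_hdot cv dw).
Qed.

End ComplexDerivative.

(** * Smooth families of curves *)

Section Families.
Variable R : realType.
Local Notation C2 := 'rV[R[i]]_2.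
Implicit Types (G : R -> R -> C2) (D : set (R * R)).

Definition deriv_s G s t := curve_deriv (G ^~ t) s.
Definition deriv_t G s t := curve_deriv (G s) t.

(** Coordinates of a family as functions of two variables, the form on which
[Ck2_on] and the interchange of derivatives are stated. *)
Definition re_coord G j s t : R := complex.Re (G s t 0 j).
Definition im_coord G j s t : R := complex.Im (G s t 0 j).

Lemma re_coord_s G j : re_coord (deriv_s G) j = partial1 (re_coord G j).
Proof. by apply/funext => s; apply/funext => t; rewrite /re_coord mxE. Qed.

Lemma im_coord_s G j : im_coord (deriv_s G) j = partial1 (im_coord G j).
Proof. by apply/funext => s; apply/funext => t; rewrite /im_coord mxE. Qed.

Lemma re_coord_t G j : re_coord (deriv_t G) j = partial2 (re_coord G j).
Proof. by apply/funext => s; apply/funext => t; rewrite /re_coord mxE. Qed.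

Lemma im_coord_t G j : im_coord (deriv_t G) j = partial2 (im_coord G j).
Proof. by apply/funext => s; apply/funext => t; rewrite /im_coord mxE. Qed.

Definition smooth_plane D G :=
  forall j, smooth2 D (re_coord G j) /\ smooth2 D (im_coord G j).

Lemma smooth_deriv_s D G : smooth_plane D G -> smooth_plane D (deriv_s G).
Proof.
by move=> GD j; have [G1 G2] := GD j; rewrite re_coord_s im_coord_s; split;
  exact: smooth2_partial1.
Qed.

Lemma smooth_derive_s D G s t : smooth_plane D G -> D (s, t) ->
  is_vderive (G ^~ t) s (deriv_s G s t).
Proof.
move=> GD Dst j; have [G1 G2] := GD j; rewrite mxE; split.
- by rewrite [X in is_derive _ _ _ X]derive1E; apply/derivableP;
  exact: smooth2_derivable1 G1 Dst.
- by rewrite [X in is_derive _ _ _ X]derive1E; apply/derivableP;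
  exact: smooth2_derivable1 G2 Dst.
Qed.

Lemma smooth_derive_t D G s t : smooth_plane D G -> D (s, t) ->
  is_vderive (G s) t (deriv_t G s t).
Proof.
move=> GD Dst j; have [G1 G2] := GD j; rewrite mxE; split.
- by rewrite [X in is_derive _ _ _ X]derive1E; apply/derivableP;
  exact: smooth2_derivable2 G1 Dst.
- by rewrite [X in is_derive _ _ _ X]derive1E; apply/derivableP;
  exact: smooth2_derivable2 G2 Dst.
Qed.

Lemma schwarz_plane D G s t : open D -> smooth_plane D G -> D (s, t) ->
  deriv_t (deriv_s G) s t = deriv_s (deriv_t G) s t.
Proof.
move=> oD GD Dst; apply/rowP => j; have [G1 G2] := GD j.
have ReE : re_coord (deriv_t (deriv_s G)) j s t = re_coord (deriv_s (deriv_t G)) j s t.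
  transitivity (partial2 (partial1 (re_coord G j)) s t);
    first by rewrite re_coord_t re_coord_s.
  by rewrite (schwarz oD G1 Dst) re_coord_s re_coord_t.
have ImE : im_coord (deriv_t (deriv_s G)) j s t = im_coord (deriv_s (deriv_t G)) j s t.
  transitivity (partial2 (partial1 (im_coord G j)) s t);
    first by rewrite im_coord_t im_coord_s.
  by rewrite (schwarz oD G2 Dst) im_coord_s im_coord_t.
by apply/eqP; rewrite eq_complex; apply/andP; split; apply/eqP.
Qed.

(** The curvature is a polynomial in the coordinates of the first two arclength
derivatives. *)
Lemma smooth1_curvature I J G t : open I -> smooth_plane (I `*` J) G -> J t ->
  smooth1 I (curvature (G ^~ t)).
Proof.
move=> oI GD Jt k.
have TD := smooth_deriv_s GD; have SD := smooth_deriv_s TD.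
pose a j s := re_coord (deriv_s G) j s t; pose b j s := im_coord (deriv_s G) j s t.
pose p j s := re_coord (deriv_s (deriv_s G)) j s t;
  pose q j s := im_coord (deriv_s (deriv_s G)) j s t.
have aI j : Ck1_on I k (a j) := smooth2_slice (TD j).1 Jt k.
have bI j : Ck1_on I k (b j) := smooth2_slice (TD j).2 Jt k.
have pI j : Ck1_on I k (p j) := smooth2_slice (SD j).1 Jt k.
have qI j : Ck1_on I k (q j) := smooth2_slice (SD j).2 Jt k.
have H j : Ck1_on I k (fun s => q j s * a j s + - (p j s * b j s)).
  exact: (Ck1_onD oI (Ck1_onM oI (qI j) (aI j)) (Ck1_onN oI (Ck1_onM oI (pI j) (bI j)))).
apply: (Ck1_on_eq oI _ (Ck1_onD oI (H 0) (H (lift ord0 0)))) => s _.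
rewrite /curvature /hdot big_ord_recl big_ord1 /a /b /p /q /re_coord /im_coord.
by rewrite ImD !ImM !ReJ !ImJ /deriv_s; ring.
Qed.

End Families.

(** * The vector fields in the frame of the tangent and the position *)

Section Frame.
Variable R : realType.
Local Notation C2 := 'rV[R[i]]_2.

Definition cdiff_eval (A B : diffpoly R) f s : R[i] := diff_eval A f s +i* diff_eval B f s.

Lemma is_cderive_diff_eval A B f s : (forall j, derivable (f^`(j)%classic) s 1) ->
  is_cderive (cdiff_eval A B f) s (cdiff_eval (total_diff A) (total_diff B) f s).
Proof. by move=> df; split; exact: is_derive_diff_eval. Qed.

Lemma mkdv_field_frame j (c : R -> C2) s : mkdv_field j c s =
  cdiff_eval (fieldN R j) (fieldM R j) (curvature c) s *: curve_deriv c s +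
  cdiff_eval 0 (fieldL R j) (curvature c) s *: c s.
Proof.
rewrite /cdiff_eval !diff_eval0.
case: j => [|j] /=; first by rewrite diff_eval1 !diff_eval0 scale1r scale0r addr0.
rewrite !scalerA -scalerDl; congr (_ *: _ + _ *: _); apply/eqP;
  rewrite eq_complex /=; apply/andP; split; apply/eqP; ring.
Qed.

Lemma cdiff_eval_step (A B A' B' : diffpoly R) f s :
  cdiff_eval (- 4%:R *: A + A') (- 4%:R *: B + B') f s =
  - 4%:R * cdiff_eval A B f s + cdiff_eval A' B' f s.
Proof.
have step (P Q : diffpoly R) : diff_eval (- 4%:R *: P + Q) f s =
    - 4%:R * diff_eval P f s + diff_eval Q f s.
  by rewrite diff_evalD diff_evalZ.
rewrite /cdiff_eval !step.
move: (diff_eval A f s) (diff_eval A' f s) (diff_eval B f s) (diff_eval B' f s) =>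
  a a' b b'.
by apply/eqP; rewrite eq_complex /=; apply/andP; split; apply/eqP; ring.
Qed.

(** Puts the vector field in the form [a T + b gamma] with [a] complex and [b]
imaginary, the coefficients being differential polynomials in the curvature. *)
Lemma Zfield_frame n (c : R -> C2) s : Zfield n c s =
  cdiff_eval (wsum (fieldN R) n) (wsum (fieldM R) n) (curvature c) s *: curve_deriv c s +
  cdiff_eval 0 (wsum (fieldL R) n) (curvature c) s *: c s.
Proof.
rewrite -[LHS]/(wsum (fun j => mkdv_field j c s) n).
elim: n => [|n IH]; first by rewrite !wsum0 mkdv_field_frame.
rewrite !wsumS IH mkdv_field_frame scalerDr !scalerA addrACA -!scalerDl.
rewrite cdiff_eval_step; congr (_ + _ *: _).
by rewrite -cdiff_eval_step scaler0 addr0.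
Qed.

End Frame.

(** * Variation of the curvature of a Legendrian curve *)

Section LegendrianFrame.
Variable R : realType.
Local Notation C2 := 'rV[R[i]]_2.

(** Expansion in the orthonormal frame of the tangent and the position.
Differentiating [<T, gamma> = 0] gives the second coefficient, and differentiating
[<T, T> = 1] shows that the first one is imaginary. *)
Lemma legendrian_frenet (I : set R) (c : R -> C2) s :
  open I -> I s -> unit_speed_legendrian I c ->
  (forall x, I x -> is_vderive c x (curve_deriv c x)) ->
  is_vderive (curve_deriv c) s (curve_deriv (curve_deriv c) s) ->
  curve_deriv (curve_deriv c) s = (0 +i* curvature c s) *: curve_deriv c s + (-1) *: c s.
Proof.
move=> oI Is leg dc dT.
have [cc Tc TT] := leg s Is.
have E1 := hdot_constant_derive oI Is (fun x Ix => let: And3 _ H _ :=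
  leg x Ix in H) dT (dc s Is).
have E2 := hdot_constant_derive oI Is (fun x Ix => let: And3 _ _ H := leg x Ix in H) dT dT.
rewrite [LHS](orthonormal_expansion _ TT cc Tc); congr (_ *: _ + _ *: _); last first.
  by apply/eqP; rewrite -addr_eq0 -TT E1.
rewrite /curvature; move: E2; rewrite [X in _ + X]hdot_conj.
case: (hdot _ _) => a b /(congr1 (@complex.Re R)) /= aa; congr (_ +i* _).
by lra.
Qed.

(** The derivative of [a T + b c] when [T' = kappa T - c] and [c' = T], with
[x] and [y] the derivatives of the coefficients. *)
Lemma frame_derivative (a b x y kappa : R[i]) (T c : C2) :
  x *: T + a *: (kappa *: T + (-1) *: c) + (y *: c + b *: T) =
  (x + a * kappa + b) *: T + (y - a) *: c.
Proof.
apply/rowP => j; rewrite !mxE; ring.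
Qed.

(** The time derivative of [Im <T_s, T>] by the product rule, when
[T_t = P T + Q c] and [T_s = i k T - c]. That [P] is imaginary removes the term
[2 k Re P]. *)
Lemma curvature_variation (k p2 p1' p2' q1 q2 q1' q2' : R) (T c : C2) :
  let Ts := (0 +i* k) *: T + (-1) *: c in
  let P := 0 +i* p2 in let Q := q1 +i* q2 in
  hdot T T = 1 -> hdot c c = 1 -> hdot T c = 0 ->
  complex.Im (hdot (((p1' +i* p2') *: T + P *: Ts) + ((q1' +i* q2') *: c + Q *: T)) T
    + hdot Ts (P *: T + Q *: c)) = p2' + 2 * q2.
Proof.
move=> Ts P Q TT cc Tc.
have cT : hdot c T = 0 by rewrite hdot_conj Tc conjc0.
rewrite /Ts !(hdotDl, hdotZl, hdotDr, hdotZr) TT cc Tc cT /P /Q /=.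
by ring.
Qed.

(** The core of the argument: with [gamma_t = (N + i M) T + i L gamma] one has
[k_t = M_ss + (k N)_s + 4 M]. The relations [N_s = k M] and [L_s = 2 M] between
the coefficients are consequences of the family being unit-speed and Legendrian at
every time; the first is the vanishing of [P1] below. *)
Lemma curvature_flow (I J : set R) (g : R -> R -> C2) (N M L : diffpoly R) s t :
  open I -> open J -> smooth_plane (I `*` J) g ->
  (forall t, J t -> unit_speed_legendrian I (g ^~ t)) ->
  (forall x, I x -> deriv_t g x t = cdiff_eval N M (curvature (g ^~ t)) x *: deriv_s g x t +
     cdiff_eval 0 L (curvature (g ^~ t)) x *: g x t) ->
  I s -> J t ->
  is_derive t 1 (fun t' => curvature (g ^~ t') s)
    (diff_eval (total_diff (total_diff M) + total_diff (dvar R 0 * N) + 4%:R *: M)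
       (curvature (g ^~ t)) s).
Proof.
move=> oI oJ gD leg gtE Is Jt.
pose D := I `*` J.
have oD : open D.
  rewrite openE => -[x y] [Ix Jy]; exists (I, J) => //=.
  by split; exact: open_nbhs_nbhs.
pose T := deriv_s g; pose Ts := deriv_s T.
have TD : smooth_plane D T := smooth_deriv_s gD.
have SD : smooth_plane D Ts := smooth_deriv_s TD.
set k := curvature (g ^~ t) in gtE *.
have dk x : I x -> forall j, derivable (k^`(j)%classic) x 1.
  by move=> Ix j; exact: smooth1_derivable (smooth1_curvature oI gD Jt) Ix.
(* [T_t = (P1 + i P2) T + (Q1 + i Q2) gamma], by differentiating the flow in [s]. *)
pose P1 := total_diff N - dvar R 0 * M.
pose P2 := total_diff M + dvar R 0 * N + L.
pose Q1 := - N.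
pose Q2 := total_diff L - M.
pose E A x := diff_eval A k x.
have EP1 x : E P1 x = E (total_diff N) x - k x * E M x.
  by rewrite /E /P1 diff_evalB diff_eval_u0M.
have EP2 x : E P2 x = E (total_diff M) x + k x * E N x + E L x.
  by rewrite /E /P2 2!diff_evalD diff_eval_u0M.
have EQ1 x : E Q1 x = - E N x by rewrite /E /Q1 diff_evalN.
have EQ2 x : E Q2 x = E (total_diff L) x - E M x by rewrite /E /Q2 diff_evalB.
have Dx x : I x -> D (x, t) by [].
have legT x : I x -> [/\ hdot (T x t) (T x t) = 1, hdot (g x t) (g x t) = 1
    & hdot (T x t) (g x t) = 0].
  by move=> Ix; have [? ? ?] := leg t Jt x Ix.
have TsE x : I x -> Ts x t = (0 +i* k x) *: T x t + (-1) *: g x t.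
  move=> Ix; apply: (legendrian_frenet oI Ix (leg t Jt)).
    by move=> y Iy; exact: smooth_derive_s gD (Dx y Iy).
  exact: smooth_derive_s TD (Dx x Ix).
have TtE x : I x -> deriv_t T x t =
  cdiff_eval P1 P2 k x *: T x t + cdiff_eval Q1 Q2 k x *: g x t.
  move=> Ix; rewrite (schwarz_plane oD gD (Dx x Ix)); apply: is_vderive_eq.
  have gtE' y : I y -> cdiff_eval N M k y *: T y t + cdiff_eval 0 L k y *: g y t =
    deriv_t g y t.
    by move=> Iy; rewrite gtE.
  apply: is_vderive_near (open_near oI Ix gtE') _.
  have := is_vderiveD
    (is_vderiveZ (is_cderive_diff_eval N M (dk x Ix)) (smooth_derive_s TD (Dx x Ix)))
    (is_vderiveZ (is_cderive_diff_eval 0 L (dk x Ix)) (smooth_derive_s gD (Dx x Ix))).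
  congr is_vderive; rewrite -/T -/Ts TsE// frame_derivative.
  congr (_ *: _ + _ *: _); apply/eqP; rewrite eq_complex /=; apply/andP; split; apply/eqP.
  - by apply: etrans (esym (EP1 x)); rewrite (diff_eval0 k x) /E; ring.
  - by apply: etrans (esym (EP2 x)); rewrite /E; ring.
  - by apply: etrans (esym (EQ1 x)); rewrite total_diff0 (diff_eval0 k x) /E; ring.
  - by apply: etrans (esym (EQ2 x)); rewrite /E; ring.
(* The normalizations hold at all times of [J], so they may be differentiated in [t]. *)
have Jk x : I x -> hdot (deriv_t T x t) (T x t) + hdot (T x t) (deriv_t T x t) = 0.
  move=> Ix; apply: (hdot_constant_derive oJ Jt (c := T x) (d := T x) (z := 1)).
  - by move=> y Jy; case: (leg y Jy x Ix).
  - exact: smooth_derive_t TD (Dx x Ix).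
  - exact: smooth_derive_t TD (Dx x Ix).
have Jl x : I x -> hdot (deriv_t T x t) (g x t) + hdot (T x t) (deriv_t g x t) = 0.
  move=> Ix; apply: (hdot_constant_derive oJ Jt (c := T x) (d := g x) (z := 0)).
  - by move=> y Jy; case: (leg y Jy x Ix).
  - exact: smooth_derive_t TD (Dx x Ix).
  - exact: smooth_derive_t gD (Dx x Ix).
have P10 x : I x -> E P1 x = 0.
  move=> Ix; have [TT cc Tc] := legT x Ix.
  have cT : hdot (g x t) (T x t) = 0 by rewrite hdot_conj Tc conjc0.
  have := congr1 (@complex.Re R) (Jk x Ix).
  rewrite TtE// !(hdotDl, hdotZl, hdotDr, hdotZr) TT cT Tc /= -/(E P1 x) => H.
  by lra.
have LM x : I x -> E (total_diff L) x = 2 * E M x.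
  move=> Ix; have [TT cc Tc] := legT x Ix.
  have := congr1 (@complex.Im R) (Jl x Ix).
  rewrite gtE// TtE// !(hdotDl, hdotZl, hdotDr, hdotZr) TT cc Tc /= -/(E Q2 x) EQ2 -/(E
    M x) => H.
  by lra.
have dTs : deriv_t Ts s t = cdiff_eval (total_diff P1) (total_diff P2) k s *: T s t +
    cdiff_eval P1 P2 k s *: Ts s t +
    (cdiff_eval (total_diff Q1) (total_diff Q2) k s *: g s t +
      cdiff_eval Q1 Q2 k s *: T s t).
  rewrite (schwarz_plane oD TD (Dx s Is)); apply: is_vderive_eq.
  have TtE' y : I y -> cdiff_eval P1 P2 k y *: T y t + cdiff_eval Q1 Q2 k y *: g y t =
    deriv_t T y t.
    by move=> Iy; rewrite TtE.
  apply: is_vderive_near (open_near oI Is TtE') _.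
  exact: is_vderiveD
    (is_vderiveZ (is_cderive_diff_eval P1 P2 (dk s Is)) (smooth_derive_s TD (Dx s Is)))
    (is_vderiveZ (is_cderive_diff_eval Q1 Q2 (dk s Is)) (smooth_derive_s gD (Dx s Is))).
have PE : cdiff_eval P1 P2 k s = 0 +i* E P2 s.
  by apply/eqP; rewrite eq_complex /=; apply/andP; split; apply/eqP => //; exact: P10.
have [_ kt] := is_cderive_hdot (smooth_derive_t SD (Dx s Is)) (smooth_derive_t TD (Dx s
  Is)).
apply: (is_derive_congr kt) => //.
have [TT cc Tc] := legT s Is.
rewrite dTs (TtE s Is) PE (TsE s Is) curvature_variation// -/(E Q2 s) EQ2 (LM s Is).
have -> : diff_eval (total_diff P2) k s = E (total_diff (total_diff M)) s +
    E (total_diff (dvar R 0 * N)) s + E (total_diff L) s.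
  by rewrite /E /P2 total_diffD total_diffD 2!diff_evalD.
rewrite (LM s Is) [RHS]diff_evalD diff_evalD diff_evalZ /E; ring.
Qed.

End LegendrianFrame.

Theorem mainTheorem4 (R : realType) (n : nat) (I J : set R)
    (g : R -> R -> 'rV[R[i]]_2) :
  (1 <= n)%N ->
  open I -> is_interval I -> open J -> is_interval J ->
  smooth_family I J g ->
  (forall t, J t -> unit_speed_legendrian I (g ^~ t)) ->
  (forall s t, I s -> J t -> curve_deriv (g s) t = Zfield n (g ^~ t) s) ->
  forall s t, I s -> J t ->
    is_derive t 1 (fun t' => curvature (g ^~ t') s)
      (diff_eval (mkdvM R n.+1) (curvature (g ^~ t)) s).
Proof.
move=> _ oI _ oJ _ gIJ leg flow s t Is Jt.
have gD : smooth_plane (I `*` J) g by move=> j; split=> k; case: (gIJ k j).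
rewrite -(mkdv_telescope R n).
apply: (curvature_flow oI oJ gD leg _ Is Jt (L := wsum (fieldL R) n)) => x Ix.
by rewrite -Zfield_frame; exact: flow.
Qed.
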